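(* Let $n\ge 1$. For all $A,A',a>0$ there exists a constant $D$, depending only on $A$, $A'$, $a$ and the dimension $n$, and a constant $C$, such that, with $$a'=a(1+2aA)\big(1+A'a(1+2aA)\big),$$ for all $u\in L^1(\mathbb{R}^n;\gamma)$ and all $\sigma>0$ we have $$\gamma\big(\{x\in\mathbb{R}^n\colon T^*_{(A,a)}u(x)>D\sigma\}\big)\le C\,\gamma\big(\{x\in\mathbb{R}^n\colon T^*_{(A',a')}u(x)>\sigma\}\big),$$ with $C$ independent of $u$ and $\sigma$. In particular, there is a constant $C'$, independent of $u$, such that for all $u\in L^1(\mathbb{R}^n;\gamma)$ $$\|T^*_{(A,a)}u\|_{L^1(\mathbb{R}^n;\gamma)}\le C'\,\|T^*_{(A',a')}u\|_{L^1(\mathbb{R}^n;\gamma)}.$$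
   Context: $\gamma$ is the standard gaussian measure on $\mathbb{R}^n$, $d\gamma(x)=(2\pi)^{-n/2}\exp(-\tfrac12|x|^2)\,dx$. $L$ is the Ornstein-Uhlenbeck operator, $Lf(x)=-\Delta f(x)+x\cdot\nabla f(x)$, and $(e^{-tL})_{t\ge 0}$ is the Ornstein-Uhlenbeck semigroup, given for $t>0$ by $e^{-tL}u(x)=\int_{\mathbb{R}^n}u\big(e^{-t}x+\sqrt{1-e^{-2t}}\,y\big)\,d\gamma(y)$. $B(y,t)$ is the euclidean ball with centre $y$ and radius $t$. Put $m(x)=\min\{1,\frac1{|x|}\}$ (with $m(0)=1$). For $A,a>0$ and $x\in\mathbb{R}^n$ the admissible cone with parameters $A,a$ based at $x$ is $$\Gamma_x^{(A,a)}(\gamma)=\{(y,t)\in\mathbb{R}^n\times(0,\infty)\colon |y-x|<At \text{ and } t<a\,m(x)\},$$ and the non-tangential maximal function with parameters $A,a$ is $$T^*_{(A,a)}u(x)=\sup_{(y,t)\in\Gamma_x^{(A,a)}(\gamma)}\Big(\frac{1}{\gamma(B(y,At))}\int_{B(y,At)}|e^{-t^2L}u(z)|^2\,d\gamma(z)\Big)^{1/2}.$$ *)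

(* Defs.v *)
From HB Require Import structures.
From mathcomp Require Import all_boot all_order all_algebra.
From mathcomp Require Import all_classical all_reals all_analysis.
From mathcomp Require Import measurable_realfun.

Set Implicit Arguments.
Unset Strict Implicit.
Unset Printing Implicit Defensive.

Import Order.TTheory GRing.Theory Num.Theory.
Import numFieldNormedType.Exports.

Local Open Scope classical_set_scope.
Local Open Scope ring_scope.

(* R^n is the type [n.-tuple R], which carries the product (= Borel)
   sigma-algebra. *)

Section euclidean.
Context {R : realType} {n : nat}.
Implicit Types x y : n.-tuple R.

Definition eucl_norm x : R := Num.sqrt (\sum_(i < n) tnth x i ^+ 2).

Definition eucl_dist x y : R :=
  Num.sqrt (\sum_(i < n) (tnth x i - tnth y i) ^+ 2).

Definition euclidean_ball x (r : R) : set (n.-tuple R) :=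
  [set z | eucl_dist z x < r].

End euclidean.

Section lebesgue_Rn.
Context {R : realType}.

Definition tcons n (p : measurableTypeR R * n.-tuple R) : n.+1.-tuple R :=
  [tuple of (p.1 : R) :: p.2].

Definition tuncons n (x : n.+1.-tuple R) : measurableTypeR R * n.-tuple R :=
  (thead x : measurableTypeR R, [tuple of behead x]).

Lemma tconsK n : cancel (@tcons n) (@tuncons n).
Proof.
by move=> [a x]; congr pair; rewrite ?theadE//; apply: val_inj.
Qed.

Lemma tunconsK n : cancel (@tuncons n) (@tcons n).
Proof. by move=> x; rewrite [RHS]tuple_eta; apply: val_inj. Qed.

Lemma measurable_tcons n : measurable_fun setT (@tcons n).
Proof.
exact: (measurable_cons (f := fst : measurableTypeR R * n.-tuple R -> R)).
Qed.

Lemma measurable_tuncons n : measurable_fun setT (@tuncons n).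
Proof.
apply: measurable_fun_pair; last exact: measurable_behead.
exact: (@measurable_tnth _ R n.+1 ord0).
Qed.

Section step.
Context (n : nat) (mu : {sigma_finite_measure set (n.-tuple R) -> \bar R}).

Definition lebesgue_step : set (n.+1.-tuple R) -> \bar R :=
  pushforward (@lebesgue_measure R \x mu)%E (@tcons n).

Let nu := measure_function_pushforward__canonical__measure_function_Measure
  (@lebesgue_measure R \x mu)%E (@measurable_tcons n).

Let step0 : lebesgue_step set0 = 0%E. Proof. exact: (measure0 nu). Qed.

Let step_ge0 A : (0 <= lebesgue_step A)%E. Proof. exact: (measure_ge0 nu). Qed.

Let step_sigma_additive : semi_sigma_additive lebesgue_step.
Proof. exact: (@measure_semi_sigma_additive _ _ _ nu). Qed.

HB.instance Definition _ := isMeasure.Build _ _ _ lebesgue_step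
  step0 step_ge0 step_sigma_additive.

Let step_sigma_finite : sigma_finite setT lebesgue_step.
Proof.
have /sigma_finiteP[F [FT ndF Foo]] := sigma_finiteT (@lebesgue_measure R).
have /sigma_finiteP[G [GT ndG Goo]] := sigma_finiteT mu.
exists (fun k => @tuncons n @^-1` (F k `*` G k)).
  rewrite -preimage_bigcup [X in _ @^-1` X](_ : _ = setT) ?preimage_setT//.
  apply/seteqP; split => // -[x y] _.
  have [i _ Fix] : (\bigcup_k F k) x by rewrite -FT.
  have [j _ Gjy] : (\bigcup_k G k) y by rewrite -GT.
  exists (maxn i j) => //; split => /=.
  - by move: x Fix; exact/subsetPset/ndF/leq_maxl.
  - by move: y Gjy; exact/subsetPset/ndG/leq_maxr.
move=> k; have [mF Fk] := Foo k; have [mG Gk] := Goo k; split.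
  by rewrite -[X in measurable X]setTI; apply: measurable_tuncons => //;
    exact: measurableX.
rewrite /lebesgue_step /pushforward -comp_preimage.
rewrite (_ : @tuncons n \o @tcons n = id); last exact/funext/tconsK.
rewrite preimage_id.
by rewrite product_measure1E// lte_mul_pinfty// ge0_fin_numE.
Qed.

HB.instance Definition _ := @Measure_isSigmaFinite.Build _ _ _ lebesgue_step
  step_sigma_finite.

End step.

Definition lebesgue_Rn0 : set (0.-tuple R) -> \bar R := dirac [tuple].

HB.instance Definition _ := Measure.on lebesgue_Rn0.

Let lebesgue_Rn0_sigma_finite : sigma_finite setT lebesgue_Rn0.
Proof.
apply: fin_num_fun_sigma_finite; first by rewrite measure0.
by move=> A mA; rewrite /lebesgue_Rn0 diracE.
Qed.

HB.instance Definition _ := @Measure_isSigmaFinite.Build _ _ _ lebesgue_Rn0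
  lebesgue_Rn0_sigma_finite.

Fixpoint lebesgue_Rn n : {sigma_finite_measure set (n.-tuple R) -> \bar R} :=
  match n with
  | 0 => lebesgue_Rn0
  | m.+1 => lebesgue_step (lebesgue_Rn m)
  end.

Lemma lebesgue_Rn_box n (A : 'I_n -> set (measurableTypeR R)) :
  (forall i, measurable (A i)) ->
  lebesgue_Rn n [set x | forall i, A i (tnth x i)] =
  (\prod_(i < n) lebesgue_measure (A i))%E.
Proof.
elim: n A => [|n IHn] A mA.
  by rewrite big_ord0/= /lebesgue_Rn0 diracE mem_set// => -[].
rewrite big_ord_recl -IHn//= /lebesgue_step /pushforward.
rewrite -product_measure1E//; last first.
  rewrite (_ : [set x | _] =
      \bigcap_(i in setT)
        ((fun x : n.-tuple R => tnth x i) @^-1` A (lift ord0 i))).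
    apply: fin_bigcap_measurable => // i _; rewrite -[X in measurable X]setTI.
    by apply: measurable_tnth => //; exact: mA.
  by apply/seteqP; split => x /= Ax => [i _|i]; exact: Ax.
congr product_measure1; apply/seteqP; split => -[x y] /= Axy.
  split => [|i]; first exact: (Axy ord0).
  by have := Axy (lift ord0 i); rewrite tnthS.
move=> i; case: (unliftP ord0 i) => [j|] ->; last exact: Axy.1.
by rewrite tnthS; exact: Axy.2.
Qed.

End lebesgue_Rn.
Arguments lebesgue_Rn : clear implicits.

Section gaussian.
Context (R : realType) (n : nat).

Definition gaussian_pdf (x : n.-tuple R) : R :=
  (2 * pi) `^ (- (n%:R / 2)) * expR (- (eucl_norm x ^+ 2 / 2)).

Lemma gaussian_pdf_ge0 x : 0 <= gaussian_pdf x.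
Proof. by rewrite mulr_ge0 ?powR_ge0 ?expR_ge0. Qed.

Lemma measurable_gaussian_pdf : measurable_fun setT gaussian_pdf.
Proof.
rewrite (_ : gaussian_pdf = fun x : n.-tuple R =>
    (2 * pi) `^ (- (n%:R / 2)) * expR (- ((\sum_(i < n) tnth x i ^+ 2) / 2))).
  apply: measurable_funM => //; apply: measurableT_comp => //.
  apply: measurableT_comp => //; apply: measurable_funM => //.
  apply: measurable_sum => i; apply: measurable_funX.
  exact: measurable_tnth.
apply/funext => x; rewrite /gaussian_pdf /eucl_norm sqr_sqrtr//.
by apply: sumr_ge0 => i _; rewrite sqr_ge0.
Qed.

Definition gaussian : set (n.-tuple R) -> \bar R :=
  fun A => (\int[lebesgue_Rn R n]_(x in A) (gaussian_pdf x)%:E)%E.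

Let gaussian0 : gaussian set0 = 0%E.
Proof. by rewrite /gaussian integral_set0. Qed.

Let gaussian_ge0 A : (0 <= gaussian A)%E.
Proof. by apply: integral_ge0 => x _; rewrite lee_fin gaussian_pdf_ge0. Qed.

Let gaussian_sigma_additive : semi_sigma_additive gaussian.
Proof.
apply: (@semi_sigma_additive_nng_induced _ _ _ (lebesgue_Rn R n)) => [|x].
  by apply/measurable_EFinP; exact: measurable_gaussian_pdf.
by rewrite lee_fin gaussian_pdf_ge0.
Qed.

HB.instance Definition _ := isMeasure.Build _ _ _ gaussian
  gaussian0 gaussian_ge0 gaussian_sigma_additive.

End gaussian.
Arguments gaussian : clear implicits.

Section ornstein_uhlenbeck.
Context {R : realType} {n : nat}.
Implicit Types (u : n.-tuple R -> R) (x : n.-tuple R).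
Local Notation gamma := (gaussian R n).

(* Mehler's formula for e^{-tL} u (x). *)
Definition ou_semigroup (t : R) u x : R :=
  \int[gamma]_y u [tuple expR (- t) * tnth x i +
                         Num.sqrt (1 - expR (- (2 * t))) * tnth y i | i < n].

(* The case distinction is needed because 0^-1 = 0. *)
Definition admissible_radius x : R :=
  if eucl_norm x == 0 then 1 else Num.min 1 (eucl_norm x)^-1.

Definition admissible_cone (A a : R) x : set (n.-tuple R * R) :=
  [set yt | [/\ 0 < yt.2, eucl_dist yt.1 x < A * yt.2 &
                yt.2 < a * admissible_radius x]].

Definition gaussian_average (B : set (n.-tuple R)) (f : n.-tuple R -> R) :
  \bar R := ((gamma B)^-1 * \int[gamma]_(z in B) (f z)%:E)%E.

Definition nt_maximal (A a : R) u x : \bar R :=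
  ereal_sup [set sqrte (gaussian_average (euclidean_ball yt.1 (A * yt.2))
                          (fun z => `|ou_semigroup (yt.2 ^+ 2) u z| ^+ 2))
            | yt in admissible_cone A a x].

End ornstein_uhlenbeck.

(* Main.v *)
Require Import Defs.
From HB Require Import structures.
From mathcomp Require Import all_boot all_order all_algebra.
From mathcomp Require Import all_classical all_reals all_analysis.
From mathcomp Require Import measurable_realfun ring lra.
Import Order.TTheory GRing.Theory Num.Theory.
Import numFieldNormedType.Exports.
Local Open Scope classical_set_scope.
Local Open Scope ring_scope.

(** If an average over [B(y, A t)] with [(y, t)] in the small cone of [x] is
large, then, covering that ball by a grid of mesh comparable to [A' t] and using
that the gaussian density is essentially constant on balls of radius
[O(min(1, 1/|x|))], the average over some [B(z, A' t)] with [z] in [B(y, A t)]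
is large too.  The pair [(z, t)] then belongs to the big cone of every point of
[B(z, A' t)], so this ball lies in the superlevel set [E] of the larger maximal
function, at distance [O(t)] from [x].  Inside each such ball choose a dyadic
cube of side comparable to [t]: the maximal cubes among these are disjoint
subsets of [E], while their dilates by a fixed factor cover the superlevel set of
the smaller maximal function, and a dilate has gaussian measure at most a
constant times that of the cube.  The norm inequality follows by summing over
levels. *)

(** * Euclidean distance: triangle inequality and comparison with coordinates *)

Section euclidean_geometry.
Context {R : realType} {n : nat}.
Implicit Types (x y z v w : n.-tuple R) (r h : R).

Lemma minkowski_sqrt (a b : 'I_n -> R) :
  Num.sqrt (\sum_i (a i + b i) ^+ 2) <=
  Num.sqrt (\sum_i a i ^+ 2) + Num.sqrt (\sum_i b i ^+ 2).
Proof.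
have sq_ge0 (c : 'I_n -> R) : 0 <= \sum_i c i ^+ 2.
  by apply: sumr_ge0 => i _; exact: sqr_ge0.
set A := \sum_i a i ^+ 2; set B := \sum_i b i ^+ 2.
pose S := \sum_i a i * b i.
have abE : \sum_i (a i + b i) ^+ 2 = A + 2 * S + B.
  rewrite mulr_sumr -!big_split/=; apply: eq_bigr => i _; ring.
(* Cauchy-Schwarz: the nonnegative sum of the squares [(B * a i - S * b i) ^+ 2] equals
   [B * (A * B - S ^+ 2)], and [B = 0] forces [S = 0]. *)
have cs : S ^+ 2 <= A * B.
  have : 0 <= \sum_i (B * a i - S * b i) ^+ 2 := sq_ge0 _.
  rewrite (_ : \sum_i _ = B * (A * B - S ^+ 2)); last first.
    rewrite (eq_bigr (fun i => B ^+ 2 * a i ^+ 2 - 2 * B * S * (a i * b i) +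
      S ^+ 2 * b i ^+ 2)); last by move=> i _; ring.
    rewrite big_split/= sumrB -!mulr_sumr -/A -/B -/S; ring.
  have [B0 _|B_gt0] := leP B 0; last by rewrite pmulr_rge0// subr_ge0.
  have /eqP : B = 0 by apply/eqP; rewrite eq_le B0 sq_ge0.
  rewrite psumr_eq0; last by move=> i _; exact: sqr_ge0.
  move=> /allP b0; rewrite /S big1 ?expr0n ?mulr_ge0 ?sq_ge0// => i _.
  by have := b0 i (mem_index_enum _); rewrite /= sqrf_eq0 => /eqP ->; rewrite mulr0.
have A0 := sq_ge0 a; have B0 := sq_ge0 b.
have sA := sqr_sqrtr A0; have sB := sqr_sqrtr B0.
have sA0 := sqrtr_ge0 A; have sB0 := sqrtr_ge0 B.
rewrite -[leRHS]ger0_norm ?addr_ge0// -sqrtr_sqr ler_wsqrtr// abE.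
suff ? : S <= Num.sqrt A * Num.sqrt B by rewrite sqrrD sA sB -/A -/B; lra.
apply: le_trans (ler_norm _) _.
by rewrite -sqrtr_sqr -sqrtrM// ler_wsqrtr.
Qed.

Lemma eucl_dist_ge0 x y : 0 <= eucl_dist x y. Proof. exact: sqrtr_ge0. Qed.

Lemma eucl_norm_ge0 x : 0 <= eucl_norm x. Proof. exact: sqrtr_ge0. Qed.

Lemma eucl_distxx x : eucl_dist x x = 0.
Proof. by rewrite /eucl_dist big1 ?sqrtr0// => i _; rewrite subrr expr0n. Qed.

Lemma eucl_distC x y : eucl_dist x y = eucl_dist y x.
Proof.
by congr Num.sqrt; apply: eq_bigr => i _; rewrite -sqrrN opprB.
Qed.

Lemma eucl_dist_triangle y x z :
  eucl_dist x z <= eucl_dist x y + eucl_dist y z.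
Proof.
apply: le_trans (minkowski_sqrt _ _); rewrite le_eqVlt; apply/orP; left.
by apply/eqP; congr Num.sqrt; apply: eq_bigr => i _; rewrite subrKA.
Qed.

Lemma eucl_norm_triangle x y : eucl_norm y <= eucl_norm x + eucl_dist x y.
Proof.
rewrite eucl_distC addrC; apply: le_trans (minkowski_sqrt _ _).
rewrite le_eqVlt; apply/orP; left.
by apply/eqP; congr Num.sqrt; apply: eq_bigr => i _; rewrite subrK.
Qed.

Lemma coord_le_eucl_dist x y i : `|tnth x i - tnth y i| <= eucl_dist x y.
Proof.
rewrite -sqrtr_sqr ler_wsqrtr// (bigD1 i)//= lerDl.
by apply: sumr_ge0 => j _; exact: sqr_ge0.
Qed.

(** The crude factor [n] instead of its square root suffices, as only the existence of constants
    matters. With no coordinate the strict inequality would fail. *)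
Lemma eucl_dist_lt_coord x y h : (1 <= n)%N ->
  (forall i, `|tnth x i - tnth y i| < h) -> eucl_dist x y < n%:R * h.
Proof.
move=> n1 xyh.
have h0 : 0 < h := le_lt_trans (normr_ge0 _) (xyh (Ordinal n1)).
have nh0 : 0 < n%:R * h by rewrite mulr_gt0// ltr0n.
rewrite -[ltRHS]gtr0_norm// -sqrtr_sqr ltr_sqrt ?exprn_gt0//.
apply: (@lt_le_trans _ _ (\sum_(i < n) h ^+ 2)).
  apply: ltr_sum => [|i _]; first by
    apply/hasP; exists (Ordinal n1); rewrite ?mem_index_enum.
  by rewrite -(real_normK (num_real (_ - _))) ltr_pXn2r ?nnegrE// ltW.
rewrite sumr_const card_ord -(mulr_natl (h ^+ 2)) exprMn ler_wpM2r ?sqr_ge0// expr2.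
by rewrite ler_peMl ?ler0n// ler1n.
Qed.

End euclidean_geometry.

(** * Dyadic cubes *)

Section cubes.
Context {R : realType} {n : nat}.
Implicit Types (x y z v w : n.-tuple R) (r h : R) (m : {ffun 'I_n -> int}).

(** Half-open grid cubes are encoded by integer vectors, so that two points share a cube exactly
    when their cells are equal. *)
Definition cell h v : {ffun 'I_n -> int} :=
  [ffun i => Num.floor (tnth v i / h)].

Definition cube h m : set (n.-tuple R) := [set v | cell h v = m].

Lemma cubeE h m : 0 < h -> cube h m =
  [set v | forall i, `[(m i)%:~R * h, (m i + 1)%:~R * h[%classic (tnth v i)].
Proof.
move=> h0; have floorE (i : 'I_n) v :
    (Num.floor (tnth v i / h) == m i) =
    (tnth v i \in `[(m i)%:~R * h, (m i + 1)%:~R * h[).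
  by rewrite floor_eq in_itv/= ler_pdivlMr// ltr_pdivrMr.
apply/seteqP; split => v /= => [vm i|vm].
  suff : tnth v i \in `[(m i)%:~R * h, (m i + 1)%:~R * h[ by [].
  by rewrite -floorE -vm ffunE.
by apply/ffunP => i; rewrite ffunE; apply/eqP; rewrite floorE; exact: vm.
Qed.

Lemma measurable_box (A : 'I_n -> set (measurableTypeR R)) :
  (forall i, measurable (A i)) ->
  measurable [set x : n.-tuple R | forall i, A i (tnth x i)].
Proof.
move=> mA; rewrite (_ : [set x | _] =
    \bigcap_(i in setT) ((fun x : n.-tuple R => tnth x i) @^-1` A i)).
  apply: fin_bigcap_measurable => // i _; rewrite -[X in measurable X]setTI.
  by apply: measurable_tnth => //; exact: mA.
by apply/seteqP; split => x /= Ax => [i _|i]; exact: Ax.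
Qed.

Lemma measurable_cube h m : 0 < h -> measurable (cube h m).
Proof.
move=> h0; rewrite cubeE//.
exact: (measurable_box (fun i => `[(m i)%:~R * h, (m i + 1)%:~R * h[%classic)).
Qed.

Lemma lebesgue_box (l : 'I_n -> R) (b : R) (hb : 0 <= b) :
  lebesgue_Rn R n [set x | forall i, `[l i, l i + b]%classic (tnth x i)] =
  (b ^+ n)%:E.
Proof.
rewrite (lebesgue_Rn_box (A := fun i => `[l i, l i + b]%classic))//.
rewrite (eq_bigr (fun=> b%:E)) => [|i _].
  by rewrite prodEFin prodr_const card_ord.
rewrite lebesgue_measure_itv/= lte_fin ltrDl; case: ltP => [_|b0].
  by rewrite -EFinB addrAC subrr add0r.
by congr EFin; apply/eqP; rewrite eq_le hb b0.
Qed.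

Lemma lebesgue_cube h m : 0 < h -> lebesgue_Rn R n (cube h m) = (h ^+ n)%:E.
Proof.
move=> h0; rewrite cubeE// (lebesgue_Rn_box
  (A := fun i => `[(m i)%:~R * h, (m i + 1)%:~R * h[%classic))//.
rewrite (eq_bigr (fun=> h%:E)) => [|i _].
  by rewrite prodEFin prodr_const card_ord.
rewrite lebesgue_measure_itv/= lte_fin ltr_pM2r// ltr_int ltrDl ltr01.
by rewrite -EFinB -mulrBl rmorphD/= addrAC subrr add0r mul1r.
Qed.

Lemma cell_close h v w i : 0 < h -> cell h v = cell h w ->
  `|tnth v i - tnth w i| < h.
Proof.
move=> h0 /ffunP/(_ i); rewrite !ffunE => /eqP; rewrite floor_eq.
have /andP[w1 w2] := floor_itv (tnth w i / h).
set k := Num.floor _ in w1 w2 *; move=> /andP[v1 v2].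
move: w1 w2 v1 v2; rewrite !ler_pdivlMr// !ltr_pdivrMr// rmorphD/= mulrDl mul1r.
by move=> w1 w2 v1 v2; rewrite ltr_norml; apply/andP; split; lra.
Qed.

(** Dyadic nesting: an integer [k] is at most [a / (2 * h)] iff the integer [2 * k] is at most
    [a / h], so the fine floor determines the coarse one. *)
Lemma cell_double h v w : 0 < h ->
  cell h v = cell h w -> cell (2 * h) v = cell (2 * h) w.
Proof.
move=> h0 /ffunP vw; apply/ffunP => i; have := vw i; rewrite !ffunE => vwi.
suff le_floor2 a b : Num.floor (a / h) = Num.floor (b / h) ->
    Num.floor (a / (2 * h)) <= Num.floor (b / (2 * h)).
  by apply/eqP; rewrite eq_le !le_floor2.
move=> ab; rewrite floor_ge_int.
have half (c k : R) : (k <= c / (2 * h)) = (2 * k <= c / h).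
  by rewrite !ler_pdivlMr ?mulr_gt0//; congr (_ <= _); ring.
have := floor_le (a / (2 * h)); rewrite !half.
by rewrite -[2]/(2%:~R) -intrM -!floor_ge_int ab.
Qed.

Lemma cell_dyadic h v w (k k' : nat) : 0 < h -> (k <= k')%N ->
  cell (h / 2 ^+ k') v = cell (h / 2 ^+ k') w ->
  cell (h / 2 ^+ k) v = cell (h / 2 ^+ k) w.
Proof.
move=> h0; elim: k' => [|k' IH]; first by rewrite leqn0 => /eqP ->.
rewrite leq_eqVlt => /orP[/eqP -> //|kk'] vw; apply: IH => //.
rewrite (_ : h / _ = 2 * (h / 2 ^+ k'.+1)); last first.
  have p0 : 2 ^+ k' != 0 :> R by rewrite expf_neq0.
  by rewrite exprS; field; rewrite ?p0.
by apply: cell_double => //; rewrite divr_gt0// exprn_gt0.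
Qed.

Lemma cube_sub_ball h z r : (1 <= n)%N -> 0 < h -> n%:R * h <= r ->
  cube h (cell h z) `<=` euclidean_ball z r.
Proof.
move=> n1 h0 hr v vz; apply: lt_le_trans hr.
by apply: eucl_dist_lt_coord => // i; apply: cell_close.
Qed.

Lemma dyadic_small (r h : R) : 0 < r -> 0 < h -> exists k : nat, h / 2 ^+ k <= r.
Proof.
move=> r0 h0; exists (Num.bound (h / r)).
rewrite ler_pdivrMr ?exprn_gt0// mulrC -ler_pdivrMr// ltW//.
by apply: upper_nthrootP; exact: leqnn.
Qed.

(** Such a set is the union of the countably many dyadic cubes that it contains. *)
Lemma measurable_eucl_open (U : set (n.-tuple R)) : (1 <= n)%N ->
  (forall x, U x -> exists2 r : R, 0 < r & euclidean_ball x r `<=` U) ->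
  measurable U.
Proof.
move=> n1 oU.
pose P := [set km : nat * {ffun 'I_n -> int} | cube (1 / 2 ^+ km.1) km.2 `<=` U].
have h0 (k : nat) : 0 < 1 / 2 ^+ k :> R by rewrite divr_gt0// exprn_gt0.
rewrite (_ : U = \bigcup_(km in P) cube (1 / 2 ^+ km.1) km.2); last first.
  apply/seteqP; split => [x Ux|x [km Pkm]]; last exact: Pkm.
  have [r r0 xrU] := oU _ Ux.
  have rn0 : 0 < r / n%:R by rewrite divr_gt0// ltr0n.
  have [k kr] := dyadic_small (r / n%:R) 1 rn0 ltr01.
  exists (k, cell (1 / 2 ^+ k) x) => //.
  apply: subset_trans xrU; apply: cube_sub_ball => //=.
  by rewrite mulrC -ler_pdivlMr// ltr0n.
rewrite bigcup_mkcond; apply: countable_bigcupT_measurable => // -[k m].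
by case: ifPn => // _; exact: measurable_cube.
Qed.

Lemma measurable_euclidean_ball x r : (1 <= n)%N ->
  measurable (euclidean_ball x r).
Proof.
move=> n1; apply: measurable_eucl_open => // y xy.
exists (r - eucl_dist y x); first by rewrite subr_gt0; exact: xy.
move=> z yz; apply: le_lt_trans (eucl_dist_triangle y _ _) _.
by rewrite -ltrBrDr.
Qed.

End cubes.

(** * The gaussian density at the admissible scale *)

Section admissible.
Context {R : realType} {n : nat}.
Implicit Types (x y z v w : n.-tuple R) (c s : R).

Lemma lt_admissible_radius s x :
  (s < admissible_radius x) = (s < 1) && (s * eucl_norm x < 1).
Proof.
rewrite /admissible_radius; case: eqVneq => [->|x0].
  by rewrite mulr0 ltr01 andbT.
rewrite lt_min; congr (_ && _).
by rewrite -ltr_pdivlMr ?div1r// lt_neqAle eq_sym x0 eucl_norm_ge0.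
Qed.

Lemma le_admissible_radius s x :
  (s <= admissible_radius x) = (s <= 1) && (s * eucl_norm x <= 1).
Proof.
rewrite /admissible_radius; case: eqVneq => [->|x0].
  by rewrite mulr0 ler01 andbT.
rewrite le_min; congr (_ && _).
by rewrite -ler_pdivlMr ?div1r// lt_neqAle eq_sym x0 eucl_norm_ge0.
Qed.

Lemma admissible_radius_gt0 x : 0 < admissible_radius x.
Proof. by rewrite lt_admissible_radius mul0r ltr01. Qed.

Lemma admissible_radius_le x :
  admissible_radius x <= 1 /\ admissible_radius x * eucl_norm x <= 1.
Proof. by apply/andP; rewrite -le_admissible_radius. Qed.

(** Writing m for the admissible radius, m(x)|w| is at most m(x)|x| + m(x)|x - w|, hence at most 1 +
    c. *)
Lemma admissible_radius_shift c x w : 0 <= c ->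
  eucl_dist x w <= c * admissible_radius x ->
  admissible_radius x <= (1 + c) * admissible_radius w.
Proof.
move=> c0 xw; have [m1 mx] := admissible_radius_le x.
have m0 := admissible_radius_gt0 x.
have c1 : 0 < 1 + c by lra.
rewrite -ler_pdivrMl// mulrC le_admissible_radius mulrAC !ler_pdivrMr// !mul1r.
apply/andP; split; first lra.
apply: le_trans (_ : _ <= admissible_radius x * (eucl_norm x + eucl_dist x w)) _.
  by rewrite ler_pM2l// eucl_norm_triangle.
rewrite mulrDr lerD//; apply: le_trans (_ : _ <= 1 * eucl_dist x w) _.
  by rewrite ler_wpM2r// eucl_dist_ge0.
by rewrite mul1r (le_trans xw)// ler_piMr.
Qed.

(** Bounds the ratio of the densities at two points [x], [v] with |v - x| at most c m(x). *)
Definition gauss_osc c : R := expR (c + c ^+ 2 / 2).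

Lemma gauss_osc_gt0 c : 0 < gauss_osc c. Proof. exact: expR_gt0. Qed.

Lemma gaussian_pdf_gt0 x : 0 < gaussian_pdf x.
Proof. by rewrite mulr_gt0 ?expR_gt0// powR_gt0// mulr_gt0// pi_gt0. Qed.

(* With d = |v - x|, both [|x| d <= c] and [d <= c] hold, so that |v|^2 and
   |x|^2 differ by at most [2 c + c^2]. *)
Lemma gaussian_pdf_osc c x v : 0 <= c ->
  eucl_dist v x <= c * admissible_radius x ->
  gaussian_pdf v <= gauss_osc c * gaussian_pdf x /\
  gaussian_pdf x <= gauss_osc c * gaussian_pdf v.
Proof.
move=> c0; have [m1 mx] := admissible_radius_le x.
have m0 := admissible_radius_gt0 x.
have := eucl_norm_triangle x v; have := eucl_norm_triangle v x.
rewrite (eucl_distC x v); have := eucl_dist_ge0 v x.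
have := eucl_norm_ge0 x; have := eucl_norm_ge0 v.
rewrite /gaussian_pdf /gauss_osc.
set d := eucl_dist v x; set X := eucl_norm x; set V := eucl_norm v.
move: m1 mx m0; rewrite -/X; set m := admissible_radius x.
move=> m1 mX m0 V0 X0 d0 XV VX dm.
have dc : d <= c by rewrite (le_trans dm)// ler_piMr.
have dX : d * X <= c.
  apply: le_trans (_ : _ <= c * m * X) _; first by rewrite ler_wpM2r.
  by rewrite -mulrA ler_piMr.
have dd : d ^+ 2 <= c ^+ 2 by rewrite ler_pXn2r// nnegrE.
have VX2 : V ^+ 2 <= X ^+ 2 + 2 * c + c ^+ 2.
  apply: le_trans (_ : _ <= (X + d) ^+ 2) _.
    by rewrite ler_pXn2r// nnegrE// addr_ge0.
  by rewrite sqrrD; lra.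
have XV2 : X ^+ 2 <= V ^+ 2 + 2 * c + c ^+ 2.
  (* Squaring [X - d <= V] requires [d <= X]; otherwise [X ^+ 2] is at most [c ^+ 2] already. *)
  have [dltX|Xd] := leP d X.
    have : (X - d) ^+ 2 <= V ^+ 2.
      by rewrite ler_pXn2r// ?nnegrE ?subr_ge0//; lra.
    by rewrite sqrrB; have := sqr_ge0 d; have := sqr_ge0 c; lra.
  have : X ^+ 2 <= d ^+ 2 by rewrite ler_pXn2r// ?nnegrE ltW.
  by have := sqr_ge0 V; lra.
rewrite !(mulrCA (expR _)) -!expRD.
by split; rewrite ler_wpM2l ?powR_ge0// ler_expR; lra.
Qed.

Lemma gaussian_le_lebesgue (p : R) (S : set (n.-tuple R)) : measurable S ->
  0 <= p -> (forall v, S v -> gaussian_pdf v <= p) ->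
  (gaussian R n S <= p%:E * lebesgue_Rn R n S)%E.
Proof.
move=> mS p0 Sp; rewrite -integral_cst//; apply: ge0_le_integral => //.
- by move=> v _; rewrite lee_fin gaussian_pdf_ge0.
- by apply/measurable_EFinP; apply: measurable_funTS; exact: measurable_gaussian_pdf.
Qed.

Lemma gaussian_ge_lebesgue (p : R) (S : set (n.-tuple R)) : measurable S ->
  0 <= p -> (forall v, S v -> p <= gaussian_pdf v) ->
  (p%:E * lebesgue_Rn R n S <= gaussian R n S)%E.
Proof.
move=> mS p0 Sp; rewrite -integral_cst//; apply: ge0_le_integral => //.
- by apply/measurable_EFinP; apply: measurable_funTS; exact: measurable_gaussian_pdf.
Qed.

Lemma gaussian_box_le c x (S : set (n.-tuple R)) (l : 'I_n -> R) (b : R) :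
  0 <= c -> 0 <= b -> measurable S ->
  (forall v, S v -> eucl_dist v x <= c * admissible_radius x) ->
  (forall v i, S v -> l i <= tnth v i <= l i + b) ->
  (gaussian R n S <= (gauss_osc c * gaussian_pdf x * b ^+ n)%:E)%E.
Proof.
move=> c0 b0 mS Sx Sl.
have gx0 : 0 <= gauss_osc c * gaussian_pdf x.
  by rewrite mulr_ge0 ?gaussian_pdf_ge0// ltW// gauss_osc_gt0.
apply: le_trans (gaussian_le_lebesgue _ S mS gx0 _) _.
  by move=> v /Sx /(gaussian_pdf_osc _ _ _ c0)[].
rewrite [leRHS]EFinM lee_wpmul2l ?lee_fin// -(lebesgue_box l _ b0).
apply: le_measure => //; rewrite ?inE//.
  exact: (measurable_box (fun i => `[l i, l i + b]%classic)).
by move=> v Sv i /=; rewrite in_itv/= Sl.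
Qed.

Lemma gaussian_cube_ge c x (h : R) m : 0 <= c -> 0 < h ->
  (forall v, cube h m v -> eucl_dist v x <= c * admissible_radius x) ->
  (((gauss_osc c)^-1 * gaussian_pdf x * h ^+ n)%:E <= gaussian R n (cube h m))%E.
Proof.
move=> c0 h0 Sx.
rewrite EFinM -(lebesgue_cube _ m h0).
apply: gaussian_ge_lebesgue; first exact: measurable_cube.
  by rewrite mulr_ge0 ?gaussian_pdf_ge0// invr_ge0 ltW// gauss_osc_gt0.
move=> v /Sx /(gaussian_pdf_osc _ _ _ c0)[_ xv].
by rewrite mulrC ler_pdivrMr ?gauss_osc_gt0// mulrC.
Qed.

End admissible.

(** * Countable disjoint covers *)

Section countable_cover.
Context {d : measure_display} {T : measurableType d} {R : realType}.
Context (mu : {measure set T -> \bar R}) (I : countType).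
Implicit Types (P : set I) (Q G : I -> set T) (f : T -> \bar R).

(** Reindexes the family by natural numbers, with the empty set at numbers that code no index in
    [P], so that results on sequences of sets apply. *)
Local Definition pickled P Q (j : nat) : set T :=
  \bigcup_(i in [set i | P i /\ pickle i = j]) Q i.

Let pickledE P Q i : P i -> pickled P Q (pickle i) = Q i.
Proof.
move=> Pi; apply/seteqP; split => [x [j [_ /(pcan_inj pickleK) <-]]//|x Qx].
by exists i.
Qed.

Let pickled_case P Q j :
  (exists2 i, P i & j = pickle i) \/ (forall Q, pickled P Q j = set0).
Proof.
have [[i [Pi ij]]|nP] := pselect (exists i, P i /\ pickle i = j).
  by left; exists i.
by right=> Q'; rewrite -subset0 => x [i [Pi ij] _]; apply: nP; exists i.
Qed.

Let pickled_bigcup P Q : \bigcup_j pickled P Q j = \bigcup_(i in P) Q i.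
Proof.
apply/seteqP; split => [x [j _ [i [Pi _] Qx]]|x [i Pi Qx]]; first by exists i.
by exists (pickle i) => //; exists i.
Qed.

Let measurable_pickled P Q j : (forall i, P i -> measurable (Q i)) ->
  measurable (pickled P Q j).
Proof.
move=> mQ; have [[i Pi ->]|->//] := pickled_case P Q j.
by rewrite pickledE//; exact: mQ.
Qed.

Let trivIset_pickled P Q : trivIset P Q -> trivIset setT (pickled P Q).
Proof.
move=> tQ j k _ _ [x [[i [Pi <-] Qi] [i' [Pi' <-] Qi']]].
by congr pickle; apply: tQ => //; exists x.
Qed.

Let bigcup_mulr_measure P Q (c : R) : (0 <= c)%R ->
  (forall i, P i -> measurable (Q i)) -> trivIset P Q ->
  (\sum_(0 <= j <oo) (c%:E * mu (pickled P Q j)) =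
   c%:E * mu (\bigcup_(i in P) Q i))%E.
Proof.
move=> c0 mQ tQ; rewrite nneseriesZl// -pickled_bigcup measure_semi_bigcup//.
- by move=> j; exact: measurable_pickled.
- exact: trivIset_pickled.
- by apply: bigcup_measurable => j _; exact: measurable_pickled.
Qed.

(** Subadditivity handles the possibly overlapping [G i], additivity the disjoint [Q i]. *)
Lemma measure_le_disjoint_cover P Q G (S : set T) (c : R) : (0 <= c)%R ->
  (forall i, P i -> measurable (Q i)) -> (forall i, P i -> measurable (G i)) ->
  trivIset P Q -> measurable S -> S `<=` \bigcup_(i in P) G i ->
  (forall i, P i -> (mu (G i) <= c%:E * mu (Q i))%E) ->
  (mu S <= c%:E * mu (\bigcup_(i in P) Q i))%E.
Proof.
move=> c0 mQ mG tQ mS SG GQ.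
rewrite -bigcup_mulr_measure//.
apply: (@le_trans _ _ (\sum_(0 <= j <oo) mu (pickled P G j))%E).
  apply: measure_sigma_subadditive => //; last by rewrite pickled_bigcup.
  by move=> j; exact: measurable_pickled.
apply: lee_nneseries => // j _.
have [[i Pi ->]|e] := pickled_case P Q j; first by rewrite !pickledE//; exact: GQ.
by rewrite !e measure0 mule0.
Qed.

Lemma ge0_le_integral_restrict f g (A B : set T) :
  (forall x, 0 <= f x)%E -> (forall x, 0 <= g x)%E ->
  (forall x, (f \_ A) x <= (g \_ B) x)%E ->
  (\int[mu]_(x in A) f x <= \int[mu]_(x in B) g x)%E.
Proof.
move=> f0 g0 fg; rewrite !ge0_integralE//; apply: le_ereal_sup => _ [h hf <-].
by exists h => // x; exact: le_trans (fg x).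
Qed.

Import HBNNSimple.

(* The integral of a nonnegative function is a supremum over simple functions
   even when the function is not measurable; countable subadditivity in the
   domain therefore needs no measurability of [f]. *)
Lemma integral_le_disjoint_cover P Q f (D : set T) (c : R) : (0 <= c)%R ->
  (forall x, (0 <= f x)%E) ->
  (forall i, P i -> measurable (Q i)) -> trivIset P Q ->
  D `<=` \bigcup_(i in P) Q i ->
  (forall i, P i -> (\int[mu]_(x in D `&` Q i) f x <= c%:E * mu (Q i))%E) ->
  (\int[mu]_(x in D) f x <= c%:E * mu (\bigcup_(i in P) Q i))%E.
Proof.
move=> c0 f0 mQ tQ DQ fQ.
rewrite ge0_integralE//; apply: ge_ereal_sup => _ [h hf <-].
have h0 x : (0 <= (h x)%:E)%E by rewrite lee_fin; exact: fun_ge0.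
have hfD A x : A x -> ((h x)%:E <= (f \_ (D `&` A)) x)%E.
  move=> Ax; apply: le_trans (hf x) _; rewrite !patchE in_setI.
  by rewrite (mem_set Ax) andbT.
rewrite -integralT_nnsfun.
apply: (@le_trans _ _ (\int[mu]_(x in \bigcup_j pickled P Q j) (h x)%:E)%E).
  apply: ge0_le_integral_restrict => // x; rewrite patch_setT patchE.
  case: ifPn => // /negP xQ; apply: le_trans (hf x) _; rewrite patchE.
  case: ifPn => // /set_mem Dx; exfalso; apply: xQ; apply/mem_set.
  by rewrite pickled_bigcup; exact: DQ.
rewrite ge0_integral_bigcup//; last 3 first.
- by move=> j; exact: measurable_pickled.
- by apply/measurable_EFinP; exact: measurable_funTS.
- exact: trivIset_pickled.
rewrite -bigcup_mulr_measure//; apply: lee_nneseries => [j _ _|j _].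
  by apply: integral_ge0.
have [[i Pi ->]|e] := pickled_case P Q j; last first.
  by rewrite e integral_set0 measure0 mule0.
rewrite pickledE//; apply: le_trans (fQ _ Pi).
apply: ge0_le_integral_restrict => // x; rewrite [leLHS]patchE.
case: ifPn => [/set_mem /hfD//|_]; rewrite patchE; case: ifP => //.
Qed.

End countable_cover.

(** * Local covering estimates *)

Section local_estimates.
Context {R : realType} {n : nat} (n1 : (1 <= n)%N).
Implicit Types (x y z v w : n.-tuple R).

Let n0 : 0 < n%:R :> R. Proof. by rewrite ltr0n. Qed.

(** The doubling estimate behind both coverings: both densities are compared with the one at [x],
    which cancels at the cost of two factors [gauss_osc c], and the volumes have ratio [b ^+ n]. *)
Lemma gaussian_box_le_cube c x (S : set (n.-tuple R)) (l : 'I_n -> R)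
    (b h : R) m :
  0 <= c -> 0 <= b -> 0 < h -> measurable S ->
  (forall v, S v -> eucl_dist v x <= c * admissible_radius x) ->
  (forall v, cube h m v -> eucl_dist v x <= c * admissible_radius x) ->
  (forall v i, S v -> l i <= tnth v i <= l i + b * h) ->
  (gaussian R n S <=
   (gauss_osc c ^+ 2 * b ^+ n)%:E * gaussian R n (cube h m))%E.
Proof.
move=> c0 b0 h0 mS Sx Qx Sl; have g0 := gauss_osc_gt0 c.
apply: le_trans (gaussian_box_le _ _ _ _ _ c0 _ mS Sx Sl) _.
  by rewrite mulr_ge0// ltW.
apply: (@le_trans _ _ ((gauss_osc c ^+ 2 * b ^+ n)%:E *
  ((gauss_osc c)^-1 * gaussian_pdf x * h ^+ n)%:E)%E).
  rewrite -EFinM lee_fin le_eqVlt; apply/orP; left; apply/eqP.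
  by rewrite exprMn; field; rewrite gt_eqF.
apply: lee_wpmul2l; last exact: gaussian_cube_ge.
by rewrite lee_fin mulr_ge0// exprn_ge0// ltW.
Qed.

Lemma eucl_ball_coord v z (r : R) i : euclidean_ball z r v ->
  tnth z i - r <= tnth v i <= tnth z i - r + 2 * r.
Proof.
move=> vz; have := le_lt_trans (coord_le_eucl_dist v z i) vz.
by rewrite ltr_norml => /andP[? ?]; apply/andP; split; lra.
Qed.

(** Taking [c = r / admissible_radius z] brings a ball of any radius within reach of the density
    estimate. *)
Lemma gaussian_ball_fin_num z (r : R) : 0 < r ->
  gaussian R n (euclidean_ball z r) \is a fin_num.
Proof.
move=> r0; rewrite ge0_fin_numE//.
have m0 := admissible_radius_gt0 z.
apply: le_lt_trans (ltry _); apply: (gaussian_box_le (r / admissible_radius z) z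
  _ (fun i => tnth z i - r) (2 * r)).
- by rewrite divr_ge0 ?ltW.
- by rewrite mulr_ge0// ltW.
- exact: measurable_euclidean_ball.
- by move=> v vz; rewrite divfK ?gt_eqF// ltW.
- by move=> v i; exact: eucl_ball_coord.
Qed.

Lemma gaussian_ball_gt0 z (r : R) : 0 < r ->
  (0 < gaussian R n (euclidean_ball z r))%E.
Proof.
move=> r0; have m0 := admissible_radius_gt0 z.
have h0 : 0 < r / n%:R by rewrite divr_gt0.
have sub := cube_sub_ball (r / n%:R) z r n1 h0.
rewrite mulrC divfK ?gt_eqF// lexx in sub; have {}sub := sub isT.
apply: (@lt_le_trans _ _ (gaussian R n (cube (r / n%:R) (cell (r / n%:R) z)))).
  apply: lt_le_trans (gaussian_cube_ge (r / admissible_radius z) z _ _ _ h0 _).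
  - rewrite lte_fin mulr_gt0 ?exprn_gt0// mulr_gt0 ?gaussian_pdf_gt0//.
    by rewrite invr_gt0 gauss_osc_gt0.
  - by rewrite divr_ge0 ?ltW.
  - by move=> v /sub vz; rewrite divfK ?gt_eqF// ltW.
apply: le_measure => //; rewrite inE; first exact: measurable_cube.
exact: measurable_euclidean_ball.
Qed.

(** The covering of a ball of radius [A * t] by cubes inside balls of radius [A' * t], in
    contrapositive form: small averages over the latter force a small average over the former. *)
Lemma local_change_of_aperture (A A' a : R) : 0 < A -> 0 < A' -> 0 < a ->
  exists2 D : R, 0 < D & forall (f : n.-tuple R -> \bar R) (s : R) x y t,
    (forall z, 0 <= f z)%E -> 0 <= s -> 0 < t -> t < a * admissible_radius x ->
    eucl_dist y x < A * t ->
    (forall z, eucl_dist z y < A * t ->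
      (\int[gaussian R n]_(v in euclidean_ball z (A' * t)) f v <=
       s%:E * gaussian R n (euclidean_ball z (A' * t)))%E) ->
    (\int[gaussian R n]_(v in euclidean_ball y (A * t)) f v <=
      (D * s)%:E * gaussian R n (euclidean_ball y (A * t)))%E.
Proof.
move=> A0 A'0 a0.
(* All points considered lie within [(A' + A + A) * t] of [x], and [t < a * admissible_radius x]. *)
pose c := (A' + A + A) * a.
have c0 : 0 <= c by rewrite mulr_ge0 ?ltW// !addr_gt0.
(* [K1] compares a ball of radius [A' * t] with a cube of side [A' * t / n]. [K2] compares the union
   of the covering cubes, inside a box of side [2 * (A' + A) * t], with a cube of side [A * t / n]
   inside the ball about [y]. *)
pose K1 := gauss_osc c ^+ 2 * (2 * n%:R) ^+ n.
pose b2 := 2 * (A + A') * n%:R / A.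
have b20 : 0 < b2 by rewrite divr_gt0// !mulr_gt0// addr_gt0.
pose K2 := gauss_osc c ^+ 2 * b2 ^+ n.
have g0 := gauss_osc_gt0 c.
have K10 : 0 < K1 by rewrite mulr_gt0// exprn_gt0// mulr_gt0.
have K20 : 0 < K2 by rewrite mulr_gt0// exprn_gt0.
exists (K1 * K2) => [|f s x y t f0 s0 t0 tax yx Hs]; first exact: mulr_gt0.
have close v z (r : R) : eucl_dist z x <= A * t + A * t -> r <= A' * t ->
    eucl_dist v z <= r -> eucl_dist v x <= c * admissible_radius x.
  move=> zx rA' vz; apply: le_trans (eucl_dist_triangle z _ _) _.
  apply: (@le_trans _ _ ((A' + A + A) * t)); first by rewrite !mulrDl; lra.
  by rewrite /c -mulrA ler_wpM2l ?ltW// !addr_gt0.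
pose h := A' * t / n%:R.
have h0 : 0 < h by rewrite divr_gt0// mulr_gt0.
have nh : n%:R * h = A' * t by rewrite /h mulrC divfK// gt_eqF.
(* The grid cubes that meet the ball of radius [A * t] about [y]. *)
pose P : set {ffun 'I_n -> int} :=
  [set m | exists2 z, eucl_dist z y < A * t & m = cell h z].
have cubeP z m : cube h m z -> cube h m = cube h (cell h z) by move=> <-.
have mU : measurable (\bigcup_(m in P) cube h m).
  rewrite bigcup_mkcond; apply: countable_bigcupT_measurable => // m.
  by case: ifPn => // _; exact: measurable_cube.
have ballx z : eucl_dist z y < A * t -> eucl_dist z x <= A * t + A * t.
  by move=> zy; apply: le_trans (eucl_dist_triangle y _ _) _; lra.
apply: (@le_trans _ _ ((s * K1)%:E * gaussian R n (\bigcup_(m in P) cube h m))%E).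
  apply: integral_le_disjoint_cover => //.
  - by rewrite mulr_ge0// ltW.
  - by move=> m _; exact: measurable_cube.
  - by move=> m m' _ _ [v [<- <-]].
  - by move=> v vy; exists (cell h v) => //; exists v.
  move=> _ [z zy ->].
  have sub : cube h (cell h z) `<=` euclidean_ball z (A' * t).
    by apply: cube_sub_ball => //; rewrite nh.
  apply: (@le_trans _ _
      (\int[gaussian R n]_(v in euclidean_ball z (A' * t)) f v)%E).
    apply: ge0_le_integral_restrict => // v; rewrite !patchE in_setI.
    case: ifPn => [/andP[_ /set_mem /sub vz]|_]; first by rewrite mem_set.
    by case: ifP.
  apply: le_trans (Hs _ zy) _; rewrite EFinM -muleA lee_wpmul2l//.
  apply: (gaussian_box_le_cube c x _ (fun i => tnth z i - A' * t)) => //.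
  - exact: measurable_euclidean_ball.
  - by move=> v vz; apply: (close _ z (A' * t)); rewrite ?ballx// ltW.
  - by move=> v /sub vz; apply: (close _ z (A' * t)); rewrite ?ballx// ltW.
  - by move=> v i; rewrite -mulrA nh; exact: eucl_ball_coord.
rewrite (_ : K1 * K2 * s = s * K1 * K2); last by rewrite mulrC mulrA.
rewrite [(_ * K2)%:E]EFinM -[leRHS]muleA; apply: lee_wpmul2l.
  by rewrite lee_fin mulr_ge0// ltW.
have h20 : 0 < A * t / n%:R by rewrite divr_gt0// mulr_gt0.
have sub2 : cube (A * t / n%:R) (cell (A * t / n%:R) y) `<=`
    euclidean_ball y (A * t).
  by apply: cube_sub_ball => //; rewrite mulrC divfK// gt_eqF.
have sub3 : \bigcup_(m in P) cube h m `<=` euclidean_ball y (A' * t + A * t).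
  move=> v [_ [z zy ->]] vz; apply: le_lt_trans (eucl_dist_triangle z _ _) _.
  by apply: ltrD => //; apply: cube_sub_ball vz => //; rewrite nh.
have close2 v (r : R) : r <= A' * t + A * t -> eucl_dist v y < r ->
    eucl_dist v x <= c * admissible_radius x.
  move=> rle vy; apply: le_trans (eucl_dist_triangle y _ _) _.
  apply: (@le_trans _ _ ((A' + A + A) * t)); first by rewrite !mulrDl; lra.
  by rewrite /c -mulrA ler_wpM2l ?ltW// !addr_gt0.
have At0 : 0 < A * t by rewrite mulr_gt0.
have At'0 : 0 < A' * t by rewrite mulr_gt0.
apply: (@le_trans _ _ (K2%:E *
    gaussian R n (cube (A * t / n%:R) (cell (A * t / n%:R) y)))%E).
  apply: (gaussian_box_le_cube c x _
    (fun i => tnth y i - (A' * t + A * t))) => //.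
  - exact: ltW.
  - by move=> v /sub3; exact: close2.
  - by move=> v /sub2; apply: close2; lra.
  - move=> v i /sub3 /eucl_ball_coord -/(_ i).
    suff -> : b2 * (A * t / n%:R) = 2 * (A' * t + A * t) by [].
    by rewrite /b2; field; rewrite !gt_eqF.
apply: lee_wpmul2l; first by rewrite lee_fin ltW.
apply: le_measure => //; rewrite inE; first exact: measurable_cube.
exact: measurable_euclidean_ball.
Qed.


Lemma local_covering_measure_le (r b a : R) : 0 < r -> 0 < b -> 0 < a ->
  exists2 C : R, 0 < C & forall S E : set (n.-tuple R),
    measurable S -> measurable E ->
    (forall x, S x -> exists z t,
      [/\ 0 < t, t < a * admissible_radius x, eucl_dist z x < b * t &
          euclidean_ball z (r * t) `<=` E]) ->
    (gaussian R n S <= C%:E * gaussian R n E)%E.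
Proof.
move=> r0 b0 a0.
(* The coarsest mesh: [t < a] always holds, so no relevant [r * t] exceeds [n%:R * h0]. *)
pose h0 := r * a / n%:R.
have h0_gt0 : 0 < h0 by rewrite divr_gt0// mulr_gt0.
pose h (k : nat) := h0 / 2 ^+ k.
have h_gt0 k : 0 < h k by rewrite divr_gt0// exprn_gt0.
have hS k : h k = 2 * h k.+1.
  have p0 : 2 ^+ k != 0 :> R by rewrite expf_neq0.
  by rewrite /h exprS; field; rewrite ?p0.
have h_le k k' : (k' <= k)%N -> h k <= h k'.
  move=> kk'; rewrite ler_pM2l// lef_pV2 ?posrE ?exprn_gt0//.
  by rewrite ler_weXn2l// ler1n.
(* From [r * t < 2 * (n%:R * h k)] follows [b * t < M * h k]: in mesh units, [M] bounds the distance
   from [z] to [x]. *)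
pose M := 2 * n%:R * b / r.
have M0 : 0 < M by rewrite divr_gt0// !mulr_gt0.
(* A point of a dilated cube is within [n%:R * ((M + 2) * h k)], so within [(M + 2) * r * t], of
   [z], which is within [b * t] of [x]. *)
pose c := ((M + 2) * r + b) * a.
have c0 : 0 < c by rewrite mulr_gt0 ?addr_gt0 ?mulr_gt0 ?addr_gt0.
pose C := gauss_osc c ^+ 2 * (2 * M + 1) ^+ n.
have C0 : 0 < C.
  by rewrite mulr_gt0 ?exprn_gt0 ?gauss_osc_gt0// addr_gt0// mulr_gt0.
exists C => // S E mS mE SE.
pose Q (km : nat * {ffun 'I_n -> int}) := cube (h km.1) km.2.
pose lo (km : nat * {ffun 'I_n -> int}) i := (km.2 i)%:~R * h km.1 - M * h km.1.
(* The cube enlarged by [M] mesh lengths on every side. *)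
pose G (km : nat * {ffun 'I_n -> int}) := [set v : n.-tuple R |
  forall i, `[lo km i, lo km i + (2 * M + 1) * h km.1]%classic (tnth v i)].
pose J := [set km : nat * {ffun 'I_n -> int} | exists x z t,
  [/\ 0 < t, t < a * admissible_radius x, eucl_dist z x < b * t &
      euclidean_ball z (r * t) `<=` E] /\
  [/\ n%:R * h km.1 <= r * t, r * t < 2 * (n%:R * h km.1) &
      km.2 = cell (h km.1) z]].
(* The maximal cubes of [J]: a smaller exponent means a coarser mesh, and no dyadic ancestor belongs
   to [J]. *)
pose P := [set km | J km /\
  forall k v, (k < km.1)%N -> Q km v -> ~ J (k, cell (h k) v)].
have cellE km v i : Q km v -> (km.2 i)%:~R * h km.1 <= tnth v i /\
    tnth v i <= (km.2 i)%:~R * h km.1 + h km.1.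
  rewrite /Q cubeE//= => /(_ i); rewrite in_itv/= => /andP[? /ltW].
  by rewrite rmorphD/= mulrDl mul1r.
have mQ km : measurable (Q km) by exact: measurable_cube.
have mG km : measurable (G km).
  exact: (measurable_box
    (fun i => `[lo km i, lo km i + (2 * M + 1) * h km.1]%classic)).
have QG km : Q km `<=` G km.
  move=> v Qv i /=; have [lv vl] := cellE km v i Qv.
  have := h_gt0 km.1; have : 0 < M * h km.1 by rewrite mulr_gt0.
  by rewrite in_itv/= /lo => ? ?; apply/andP; split; lra.
(* If two selected cubes of different meshes met, the coarser would be an ancestor in [J] of the
   finer. *)
have tP : trivIset P Q.
  move=> [k m] [k' m'] [Jm nm] [Jm' nm'] [v [Qv Qv']].
  have vm : cell (h k) v = m := Qv; have vm' : cell (h k') v = m' := Qv'.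
  have [kk'|kk'|kk'] := ltngtP k k'.
  - by exfalso; apply: (nm' k v kk' Qv'); rewrite vm.
  - by exfalso; apply: (nm k' v kk' Qv); rewrite vm'.
  - by rewrite -vm -vm' kk'.
have Jle km : J km -> (gaussian R n (G km) <= C%:E * gaussian R n (Q km))%E.
  move=> [x [z [t [[t0 tax zx _] [nh hn km2]]]]].
  have Gx v : G km v -> eucl_dist v x <= c * admissible_radius x.
    move=> Gv; apply: le_trans (eucl_dist_triangle z _ _) _.
    have Qz : Q km z by rewrite /Q km2.
    have vz : eucl_dist v z < n%:R * ((M + 2) * h km.1).
      apply: eucl_dist_lt_coord => // i; have [lz zl] := cellE km z i Qz.
      have := Gv i; rewrite /= in_itv/= /lo => /andP[lv vl].
      by rewrite ltr_norml; apply/andP; split; have := h_gt0 km.1; lra.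
    apply: (@le_trans _ _ (((M + 2) * r + b) * t)).
      rewrite mulrDl lerD// ?(ltW zx)//; apply: le_trans (ltW vz) _.
      by rewrite mulrCA -mulrA ler_wpM2l// ltW// addr_gt0.
    by rewrite /c -mulrA ler_wpM2l ?ltW// addr_gt0 ?mulr_gt0 ?addr_gt0.
  apply: (gaussian_box_le_cube c x _ (lo km)) => //.
  - exact: ltW.
  - by rewrite addr_ge0// mulr_ge0// ltW.
  - by move=> v /QG; exact: Gx.
  - by move=> v i /(_ i); rewrite /= in_itv.
have SG : S `<=` \bigcup_(km in P) G km.
  move=> x /SE[z [t [t0 tax zx zE]]].
  have [tm1 _] := admissible_radius_le x.
  have ta : t < a by apply: lt_le_trans tax _; rewrite ler_piMr// ltW.
  have rt0 : 0 < r * t by rewrite mulr_gt0.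
  have exk : exists k, n%:R * h k <= r * t.
    have [|k hk] := dyadic_small (r * t / n%:R) h0 _ h0_gt0; first exact: divr_gt0.
    by exists k; rewrite mulrC -ler_pdivlMr.
  have [k nhk kmin] := ex_minnP exk.
  (* Minimality of [k] gives this for positive [k]; for [k = 0] it comes from [t < a]. *)
  have rtk : r * t < 2 * (n%:R * h k).
    case: k kmin {nhk} => [_|k kmin].
      have -> : n%:R * h 0%N = r * a.
        by rewrite /h expr0 divr1 /h0 mulrC divfK// gt_eqF.
      have : r * t < r * a by rewrite ltr_pM2l.
      have : 0 < r * a by exact: mulr_gt0.
      by lra.
    rewrite mulrCA -hS.
    by rewrite ltNge; apply/negP => /kmin; rewrite ltnn.
  have Jk : J (k, cell (h k) z) by exists x, z, t.
  have exJ : exists k', `[< J (k', cell (h k') z) >] by exists k; apply/asboolP.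
  (* The coarsest cube of [J] around [z] is maximal, and its dilate still contains [x] because its
     mesh is at least [h k]. *)
  have [k' /asboolP Jk' k'min] := ex_minnP exJ.
  have k'k : (k' <= k)%N by apply: k'min; apply/asboolP.
  exists (k', cell (h k') z).
    split => //= j v jk' vz; rewrite (cell_dyadic h0 v z j k')//; last exact: ltnW.
    by move=> Jj; move: jk'; rewrite ltnNge k'min//; apply/asboolP.
  move=> i /=; have [lz zl] := cellE (k', cell (h k') z) z i erefl.
  have xz : `|tnth x i - tnth z i| <= M * h k'.
    apply: le_trans (coord_le_eucl_dist _ _ _) _; rewrite eucl_distC.
    apply: (@le_trans _ _ (M * h k)); last by rewrite ler_pM2l// h_le.
    apply: le_trans (ltW zx) _.
    rewrite /M mulrAC ler_pdivlMr//.
    rewrite (_ : _ * b * _ = b * (2 * (n%:R * h k))); last by ring.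
    by rewrite -mulrA ler_pM2l// mulrC ltW.
  move: xz; rewrite ler_norml => /andP[xz1 xz2].
  by rewrite in_itv/= /lo/=; move: lz zl => /= lz zl; apply/andP; split; lra.
apply: (@le_trans _ _ (C%:E * gaussian R n (\bigcup_(km in P) Q km))%E).
  apply: (@measure_le_disjoint_cover _ _ _ _ _ P Q G) => //; first exact: ltW.
  by move=> km [Jkm _]; exact: Jle.
apply: lee_wpmul2l; first by rewrite lee_fin ltW.
apply: le_measure; rewrite ?inE//.
  rewrite bigcup_mkcond; apply: countable_bigcupT_measurable => // km.
  by case: ifPn.
move=> v [km [[x [z [t [[_ _ _ zE] [nh _ kmE]]]]] _]] Qv; apply: zE.
by move: Qv; rewrite /Q kmE; exact: cube_sub_ball.
Qed.

End local_estimates.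

(** * Integrals and distribution functions *)

Section distribution_functions.
Context {d : measure_display} {T : measurableType d} {R : realType}.
Context (mu : {measure set T -> \bar R}).
Implicit Types (f g : T -> \bar R) (e : R).

(** One layer of a staircase: the sum over [k] is [e] times the number of positive integers [j] with
    [j * e < f x]. *)
Let step f e (k : nat) (x : T) : \bar R :=
  (e%:E * (\1_[set x | ((k.+1%:R * e)%:E < f x)%E] x)%:E)%E.

Let step_ge0 f e k x : 0 <= e -> (0 <= step f e k x)%E.
Proof. by move=> e0; rewrite mule_ge0// lee_fin. Qed.

Let step_sum_ge f e x (N : nat) : 0 < e -> ((N%:R * e)%:E < f x)%E ->
  ((N%:R * e)%:E <= \sum_(0 <= k <oo) step f e k x)%E.
Proof.
move=> e0 Nf.
apply: le_trans (nneseries_lim_ge N _); last first.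
  by move=> k _ _; apply: step_ge0; exact: ltW.
rewrite big_mkord (eq_bigr (fun=> e%:E)) => [|k _].
  by rewrite sumEFin sumr_const card_ord mulr_natl.
rewrite /step indicE mem_set ?mule1//=; apply: le_lt_trans Nf.
by rewrite lee_fin ler_pM2r// ler_nat.
Qed.

(** For finite [f x], the least N with f x <= N e is at least 2, so the staircase is at least (N -
    1) e, hence at least N e / 2. For infinite [f x] it exceeds every N e. *)
Let le_step_sum f e x : 0 < e -> (e%:E < f x)%E ->
  (f x <= 2%:E * \sum_(0 <= k <oo) step f e k x)%E.
Proof.
move=> e0 ef; have := step_sum_ge f e x ^~ e0.
have s0 : (0 <= \sum_(0 <= k <oo) step f e k x)%E.
  by apply: nneseries_ge0 => k _ _; apply: step_ge0; exact: ltW.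
case: (f x) ef => [r| |//]; last first.
  move=> _ sN; suff -> : (\sum_(0 <= k <oo) step f e k x = +oo)%E.
    by rewrite gt0_muley ?lte_fin.
  move: s0 sN; case: (\sum_(0 <= k <oo) _)%E => [s| //|//].
  rewrite lee_fin => s0 /(_ (Num.bound (s / e)) (ltry _)).
  rewrite lee_fin leNgt -ltr_pdivrMr//; case/negP.
  by apply: archi_boundP; rewrite divr_ge0// ltW.
rewrite lte_fin => er sN.
have exk : exists k : nat, r <= k%:R * e.
  exists (Num.bound (r / e)); rewrite -ler_pdivrMr// ltW// archi_boundP//.
  by rewrite divr_ge0 ?ltW// (lt_trans e0).
have [[|[|k]] rk kmin] := ex_minnP exk.
- by move: rk; rewrite mul0r leNgt (lt_trans e0).
- by move: rk; rewrite mul1r leNgt er.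
have kr : k.+1%:R * e < r.
  by rewrite ltNge; apply/negP => /kmin; rewrite ltnn.
apply: (@le_trans _ _ (2%:E * (k.+1%:R * e)%:E)%E).
  rewrite -EFinM lee_fin; apply: le_trans rk _; rewrite mulrA ler_pM2r//.
  by rewrite -natrM ler_nat mul2n -addnn addSn ltnS leq_addl.
by apply: lee_wpmul2l => //; apply: sN; rewrite lte_fin.
Qed.

Let step_sum_le g e x : 0 < e -> (0 <= g x)%E ->
  (\sum_(0 <= k <oo) step g e k x <= g x)%E.
Proof.
move=> e0 g0; apply: lime_le.
  by apply: is_cvg_nneseries => k _ _; apply: step_ge0; exact: ltW.
(* The second bound carries the induction: layer [N] contributes only where [g x] exceeds
   [N.+1%:R * e]. *)
apply: nearW => N; suff : (\sum_(0 <= k < N) step g e k x <= g x /\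
    \sum_(0 <= k < N) step g e k x <= (N%:R * e)%:E)%E by case.
elim: N => [|N [IH1 IH2]]; first by rewrite big_nil// mul0r.
rewrite big_nat_recr//= {2 4}/step indicE.
have SE : (N.+1%:R * e)%:E = ((N%:R * e)%:E + e%:E)%E.
  by rewrite -EFinD -natr1 mulrDl mul1r.
have [gN|gN] := boolP (x \in _); last first.
  rewrite mule0 adde0 SE; split=> //; apply: le_trans IH2 _.
  by rewrite leeDl// lee_fin ltW.
rewrite mule1 SE; split; last exact: leeD2r.
by apply: le_trans (ltW (set_mem gN)); rewrite SE leeD2r.
Qed.

Let integral_step_sum f e : 0 < e -> measurable_fun setT f ->
  (\int[mu]_x \sum_(0 <= k <oo) step f e k x =
   \sum_(0 <= k <oo) (e%:E * mu [set x | ((k.+1%:R * e)%:E < f x)%E]))%E.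
Proof.
move=> e0 mf.
have mS k : measurable [set x | ((k.+1%:R * e)%:E < f x)%E].
  by rewrite -[X in measurable X]setTI; exact: emeasurable_fun_o_infty.
rewrite integral_nneseries//; last 2 first.
- move=> k; apply: emeasurable_funM => //.
  by apply/measurable_EFinP; exact: measurable_indic.
- by move=> k x _; apply: step_ge0; exact: ltW.
apply: eq_eseriesr => k _; rewrite ge0_integralZl ?lee_fin//; last 2 first.
- by apply/measurable_EFinP; exact: measurable_indic.
- exact: ltW.
by rewrite integral_indic// setIT.
Qed.

Let measurable_step_sum f e : 0 < e -> measurable_fun setT f ->
  measurable_fun setT (fun x => \sum_(0 <= k <oo) step f e k x)%E.
Proof.
move=> e0 mf.
apply: (ge0_emeasurable_sum (h := step f e) (P := xpredT)) => [k x _ _|k _].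
  by apply: step_ge0; exact: ltW.
apply: emeasurable_funM => //; apply/measurable_EFinP; apply: measurable_indic.
by rewrite -[X in measurable X]setTI; exact: emeasurable_fun_o_infty.
Qed.

(* Compare with the sums [\sum_(k >= 1) e mu {k e < f}]: they dominate half of
   the integral over [e < f], and restricting to [e < f] is what makes the
   argument valid without finiteness of [mu]. *)
Lemma ge0_le_integral_distribution (C D : R) f g : 0 < C -> 0 < D ->
  measurable_fun setT f -> measurable_fun setT g ->
  (forall x, (0 <= f x)%E) -> (forall x, (0 <= g x)%E) ->
  (forall s, 0 < s -> (mu [set x | ((D * s)%:E < f x)%E] <=
     C%:E * mu [set x | (s%:E < g x)%E])%E) ->
  (\int[mu]_x f x <= (2 * D * C)%:E * \int[mu]_x g x)%E.
Proof.
move=> C0 D0 mf mg f0 g0 fg.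
have mS (s : R) : measurable [set x | (s%:E < f x)%E].
  by rewrite -[X in measurable X]setTI; exact: emeasurable_fun_o_infty.
have sum_ge0 h s x : 0 < s -> (0 <= \sum_(0 <= k <oo) step h s k x)%E.
  by move=> s0; apply: nneseries_ge0 => k _ _; apply: step_ge0; exact: ltW.
have trunc e : 0 < e -> (\int[mu]_(x in [set x | ((D * e)%:E < f x)%E]) f x <=
    (2 * D * C)%:E * \int[mu]_x g x)%E.
  move=> e0; have De0 : 0 < D * e by rewrite mulr_gt0.
  apply: (@le_trans _ _
      (\int[mu]_x (2%:E * \sum_(0 <= k <oo) step f (D * e) k x))%E).
    apply: ge0_le_integral_restrict => // x.
      by rewrite mule_ge0// sum_ge0.
    rewrite patch_setT patchE; case: ifPn => [/set_mem|_]; first exact: le_step_sum.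
    by rewrite mule_ge0// sum_ge0.
  rewrite ge0_integralZl//; last 2 first.
  - exact: measurable_step_sum.
  - by move=> x _; exact: sum_ge0.
  rewrite (_ : (2 * D * C)%:E = 2%:E * (D * C)%:E)%E; last by rewrite -EFinM mulrA.
  rewrite integral_step_sum// -muleA lee_wpmul2l//.
  apply: (@le_trans _ _ (\sum_(0 <= k <oo) ((D * C)%:E * (e%:E *
      mu [set x | ((k.+1%:R * e)%:E < g x)%E])))%E).
    apply: lee_nneseries => [k _ _|k _]; first by rewrite mule_ge0// lee_fin ltW.
    rewrite muleA -EFinM (_ : D * C * e = (D * e) * C); last ring.
    rewrite [(_ * C)%:E]EFinM -[leRHS]muleA lee_wpmul2l ?lee_fin ?(ltW De0)//.
    by rewrite (_ : _ * (D * e) = D * (k.+1%:R * e)) ?fg ?mulr_gt0//; ring.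
  rewrite nneseriesZl; last by move=> k _; rewrite mule_ge0// lee_fin ltW.
  rewrite lee_wpmul2l ?lee_fin ?(ltW (mulr_gt0 _ _))// -integral_step_sum//.
  apply: ge0_le_integral_restrict => // x; first exact: sum_ge0.
  by rewrite !patch_setT; exact: step_sum_le.
(* These sets increase to the set where [f] is positive; [trunc] with [e = i.+1%:R^-1] bounds each
   integral uniformly. *)
pose F (i : nat) := [set x | ((D * i.+1%:R^-1)%:E < f x)%E].
have cvgF : (\int[mu]_(x in F i) f x)%E @[i --> \oo] -->
    (\int[mu]_(x in \bigcup_i F i) f x)%E.
  apply: ge0_nondecreasing_set_cvg_integral => //.
  - move=> i j ij; apply/subsetPset => x; apply: le_lt_trans.
    by rewrite lee_fin ler_pM2l// lef_pV2 ?posrE// ler_nat.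
  - by move=> i; exact: mS.
  - by move=> i; exact: measurable_funTS.
apply: (@le_trans _ _ (\int[mu]_(x in \bigcup_i F i) f x)%E).
  apply: ge0_le_integral_restrict => // x; rewrite patch_setT patchE.
  case: ifPn => // /negP xF; rewrite leNgt; apply/negP => fx; apply: xF.
  apply/mem_set; case fxE : (f x) fx => [r| |//] fx.
    exists (Num.bound (D / r)) => //=; rewrite /F/= fxE lte_fin.
    move: fx; rewrite lte_fin => r0.
    rewrite ltr_pdivrMr// -ltr_pdivrMl// mulrC.
    apply: lt_trans (archi_boundP _) _; first by rewrite divr_ge0// ltW.
    by rewrite ltr_nat.
  by exists 0%N => //=; rewrite /F/= fxE ltry.
rewrite -(cvg_lim _ cvgF)//; apply: lime_le.
  by apply/cvg_ex; eexists; exact: cvgF.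
by apply: nearW => i; apply: trunc; rewrite invr_gt0.
Qed.

End distribution_functions.

(** * The non-tangential maximal function *)

Section nt_maximal_function.
Context {R : realType} {n : nat} (n1 : (1 <= n)%N).
Implicit Types (x y z v w : n.-tuple R) (u : n.-tuple R -> R).

Lemma nt_maximal_gtP (A a : R) u x (s : \bar R) :
  (s < nt_maximal A a u x)%E <->
  exists2 yt, admissible_cone A a x yt &
    (s < sqrte (gaussian_average (euclidean_ball yt.1 (A * yt.2))
                  (fun z => `|ou_semigroup (yt.2 ^+ 2) u z| ^+ 2)%R))%E.
Proof.
split=> [/ereal_sup_gt[_ [yt xyt <-]] syt|[yt xyt syt]]; first by exists yt.
by apply: lt_le_trans syt _; apply: ereal_sup_ubound; exists yt.
Qed.

(** Both conditions on the base point are strict: [r1] is the slack in the aperture, [r2] the slack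
    in the height. *)
Lemma admissible_cone_open (A a : R) x yt : 0 < a -> admissible_cone A a x yt ->
  exists2 r : R, 0 < r & forall w, euclidean_ball x r w ->
    admissible_cone A a w yt.
Proof.
move=> a0 [t0 yx]; move: yx t0; case: yt => y t /= yx t0.
rewrite mulrC -ltr_pdivrMr// lt_admissible_radius => /andP[ta tax].
have ta0 : 0 < t / a by rewrite divr_gt0.
pose r1 := A * t - eucl_dist y x.
pose r2 := (1 - t / a * eucl_norm x) / (t / a).
have r10 : 0 < r1 by rewrite subr_gt0.
have r20 : 0 < r2 by rewrite divr_gt0// subr_gt0.
exists (Num.min r1 r2) => [|w]; first by rewrite lt_min r10.
rewrite /euclidean_ball/= lt_min => /andP[wr1 wr2]; split=> //=.
  apply: le_lt_trans (eucl_dist_triangle x _ _) _.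
  by rewrite (eucl_distC x); move: wr1; rewrite /r1; lra.
rewrite mulrC -ltr_pdivrMr// lt_admissible_radius ta/=.
apply: le_lt_trans (_ : _ <= t / a * (eucl_norm x + eucl_dist x w)) _.
  by rewrite ler_pM2l// eucl_norm_triangle.
by move: wr2; rewrite eucl_distC /r2 ltr_pdivlMr// mulrC mulrDr; lra.
Qed.

(** The set is open: a pair in the cone of [x] that witnesses the bound stays in the cones of nearby
    points. *)
Lemma measurable_nt_maximal_gt (A a : R) u (s : \bar R) : 0 < a ->
  measurable [set x | (s < nt_maximal A a u x)%E].
Proof.
move=> a0; apply: measurable_eucl_open => // x /nt_maximal_gtP[yt xyt syt].
have [r r0 xr] := admissible_cone_open A a x yt a0 xyt.
by exists r => // w /xr wyt; apply/nt_maximal_gtP; exists yt.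
Qed.

Lemma measurable_nt_maximal (A a : R) u : 0 < a ->
  measurable_fun setT (nt_maximal A a u).
Proof.
move=> a0; apply: (measurability _ (ErealGenOInfty.measurableE R)) => //.
move=> /= _ [_ [s ->]] <-; apply: measurableI => //.
by rewrite preimage_itvoy; exact: measurable_nt_maximal_gt.
Qed.

Lemma nt_maximal_ge0 (A a : R) u x : 0 < A -> 0 < a ->
  (0 <= nt_maximal A a u x)%E.
Proof.
move=> A0 a0; have m0 := admissible_radius_gt0 x.
(* The cone must be seen to be nonempty, since the supremum of the empty set is [-oo]. *)
pose t := a * admissible_radius x / 2.
have t0 : 0 < t by rewrite divr_gt0// mulr_gt0.
apply: le_trans (sqrte_ge0 _) (ereal_sup_ubound _); exists (x, t) => //.
split=> //=; first by rewrite eucl_distxx mulr_gt0.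
by have := mulr_gt0 a0 m0; rewrite /t; lra.
Qed.

(** The denominator can be cleared because balls have finite positive gaussian measure. *)
Lemma sqrt_gaussian_average_le y (r s : R) (f : n.-tuple R -> R) :
  0 < r -> 0 <= s ->
  (sqrte (gaussian_average (euclidean_ball y r) f) <= s%:E)%E =
  (\int[gaussian R n]_(z in euclidean_ball y r) (f z)%:E <=
     (s ^+ 2)%:E * gaussian R n (euclidean_ball y r))%E.
Proof.
move=> r0 s0; have g0 := gaussian_ball_gt0 n1 y r r0.
have := gaussian_ball_fin_num n1 y r r0 => /fineK gE.
rewrite -[s in LHS]ger0_norm// -abse_EFin -sqrte_sqr lee_sqrt ?sqre_ge0//.
rewrite /gaussian_average -gE inver; move: g0; rewrite -gE lte_fin => g0.
by rewrite gt_eqF// lee_pdivrMl// muleC -EFin_expe.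
Qed.

(* Two successive shifts of the base point, from [x] to [z] and from [z] to [w],
   produce the two factors of [a']. *)
Lemma admissible_cone_shift (A A' a t : R) x z w :
  0 < A -> 0 < A' -> 0 < a -> 0 < t -> t < a * admissible_radius x ->
  eucl_dist z x < 2 * A * t -> eucl_dist z w < A' * t ->
  admissible_cone A' (a * (1 + 2 * a * A) * (1 + A' * a * (1 + 2 * a * A))) w
    (z, t).
Proof.
move=> A0 A'0 a0 t0 tx zx zw; split=> //=.
pose a1 := a * (1 + 2 * a * A).
have aA0 : 0 < 2 * a * A by rewrite !mulr_gt0.
have a10 : 0 < a1 by rewrite mulr_gt0// addr_gt0.
have xz : admissible_radius x <= (1 + 2 * a * A) * admissible_radius z.
  apply: admissible_radius_shift; first exact: ltW.
  rewrite eucl_distC; apply/ltW/(lt_le_trans zx).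
  rewrite (_ : 2 * a * A * _ = 2 * A * (a * admissible_radius x)); last by ring.
  by rewrite ler_pM2l ?mulr_gt0// ltW.
have tz : t < a1 * admissible_radius z.
  by apply: lt_le_trans tx _; rewrite -mulrA ler_pM2l.
have zw' : admissible_radius z <= (1 + A' * a1) * admissible_radius w.
  apply: admissible_radius_shift; first by rewrite mulr_ge0// ltW.
  by apply/ltW/(lt_trans zw); rewrite -mulrA ltr_pM2l.
by apply: lt_le_trans tz _; rewrite -[A' * a * _]mulrA -mulrA ler_pM2l.
Qed.

Lemma nt_maximal_distribution_le (A A' a : R) :
  0 < A -> 0 < A' -> 0 < a ->
  let a' := a * (1 + 2 * a * A) * (1 + A' * a * (1 + 2 * a * A)) in
  exists D C : R, [/\ 0 < D, 0 < C & forall u (s : R), 0 < s ->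
    (gaussian R n [set x | (D * s)%:E < nt_maximal A a u x] <=
     C%:E * gaussian R n [set x | s%:E < nt_maximal A' a' u x])%E].
Proof.
move=> A0 A'0 a0 a'.
have a'0 : 0 < a' by rewrite !mulr_gt0// addr_gt0// !mulr_gt0// addr_gt0// !mulr_gt0.
have A20 : 0 < 2 * A by rewrite mulr_gt0.
have [D D0 aperture] := local_change_of_aperture n1 A A' a A0 A'0 a0.
have [C C0 cover] := local_covering_measure_le n1 A' (2 * A) a A'0 A20 a0.
(* The change of aperture concerns averages of squares, whence the square root. The covering uses
   [2 * A] because [z] is within [A * t] of [y], and [y] of [x]. *)
exists (Num.sqrt D), C; split=> [||u s s0]; rewrite ?sqrtr_gt0//.
apply: cover => [||x]; [exact: measurable_nt_maximal_gt..|].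
move=> /nt_maximal_gtP[[y t] [/= t0 yx tx]].
rewrite ltNge sqrt_gaussian_average_le ?mulr_gt0 ?mulr_ge0 ?(ltW s0)// => /negP.
(* If no suitable [z] existed, all averages over the balls of radius [A' * t] would be small, and so
   would the one about [y]. *)
move=> yD; apply: contrapT => nz; apply: yD.
rewrite exprMn sqr_sqrtr ?(ltW D0)//.
apply: (aperture _ _ x) => //; first by rewrite sqr_ge0.
move=> z zy; rewrite -sqrt_gaussian_average_le ?mulr_gt0 ?(ltW s0)// leNgt.
apply/negP => zs; apply: nz; exists z, t; split=> //.
  by apply: le_lt_trans (eucl_dist_triangle y _ _) _; lra.
move=> w wz; apply/nt_maximal_gtP; exists (z, t) => //.
apply: (admissible_cone_shift _ _ _ _ x) => //; last by rewrite eucl_distC.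
by apply: le_lt_trans (eucl_dist_triangle y _ _) _; lra.
Qed.

End nt_maximal_function.

Theorem theorem3p1 (R : realType) (n : nat) (hn : (1 <= n)%N) (A A' a : R)
    (hA : 0 < A) (hA' : 0 < A') (ha : 0 < a) :
  let a' := a * (1 + 2 * a * A) * (1 + A' * a * (1 + 2 * a * A)) in
  (exists D C : R, [/\ 0 < D, 0 < C &
    forall u : n.-tuple R -> R,
      (gaussian R n).-integrable setT (EFin \o u) ->
    forall sigma : R, 0 < sigma ->
      (gaussian R n [set x | (D * sigma)%:E < nt_maximal A a u x] <=
       C%:E * gaussian R n [set x | sigma%:E < nt_maximal A' a' u x])%E]) /\
  (exists2 C' : R, 0 < C' &
    forall u : n.-tuple R -> R,
      (gaussian R n).-integrable setT (EFin \o u) ->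
      ('N[gaussian R n]_1[nt_maximal A a u] <=
       C'%:E * 'N[gaussian R n]_1[nt_maximal A' a' u])%E).
Proof.
move=> a'.
have a'0 : 0 < a' by rewrite !mulr_gt0// addr_gt0// !mulr_gt0// addr_gt0// !mulr_gt0.
have [D [C [D0 C0 DC]]] := nt_maximal_distribution_le hn A A' a hA hA' ha.
split; first by exists D, C; split=> // u _; exact: DC.
exists (2 * D * C) => [|u _]; first by rewrite !mulr_gt0.
rewrite !Lnorm1.
under eq_integral do rewrite gee0_abs ?nt_maximal_ge0//.
under [in leRHS]eq_integral do rewrite gee0_abs ?nt_maximal_ge0//.
apply: ge0_le_integral_distribution => //.
- exact: measurable_nt_maximal.
- exact: measurable_nt_maximal.
- by move=> x; exact: nt_maximal_ge0.
- by move=> x; exact: nt_maximal_ge0.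
- exact: DC.
Qed.
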